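(* Let $d\geq 3$ and $k\geq 4d^3/\pi$ be integers. Then \[ \vartheta(\overline{K_{k/d}})\geq \frac{k}{d}-\frac{4e\pi^2}{3}\frac{d}{k}. \] Hence, for fixed $d$, $\vartheta(\overline{K_{k/d}})=\frac{k}{d}+O\big(\frac{1}{k}\big)$ as $k\to\infty$.
   Context: For integers $k\geq 2d\geq 2$, $K_{k/d}$ has vertex set $\{0,\dots,k-1\}$, with $i,j$ adjacent iff $d\leq|i-j|\leq k-d$; $\overline{K_{k/d}}$ is its complement. The Lov\'asz theta number of $G=(V,E)$ is $\vartheta(G)=\max\{\sum_{x,y}B(x,y): B\in\mathbb{R}^{V\times V}$ symmetric positive semidefinite, $\sum_x B(x,x)=1$, $B(x,y)=0$ for $xy\in E\}$. *)

(* Defs.v *)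
From HB Require Import structures.
From mathcomp Require Import all_boot all_order all_algebra.
From mathcomp Require Import all_classical all_reals all_analysis.
From mathcomp Require Import ring lra.

Set Implicit Arguments.
Unset Strict Implicit.
Unset Printing Implicit Defensive.

Import Order.TTheory GRing.Theory Num.Theory numFieldNormedType.Exports.

Local Open Scope classical_set_scope.
Local Open Scope ring_scope.

(* A finite simple graph on the vertices 0, ..., n - 1 is given by its adjacency
   relation, a symmetric and irreflexive [rel 'I_n]. *)

(* Meaningful for 2 * d <= k and 0 < d; [`|i - j|] is the absolute difference and
   [k - d] is truncated. *)
Definition circular_clique (k d : nat) : rel 'I_k :=
  fun i j => (d <= `|i - j| <= k - d)%N.

Definition compl_graph (n : nat) (e : rel 'I_n) : rel 'I_n :=
  fun x y => (x != y) && ~~ e x y.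

Definition psd (R : realType) (n : nat) (B : 'M[R]_n) : Prop :=
  B^T = B /\ forall v : 'cV[R]_n, 0 <= (v^T *m B *m v) 0 0.

Definition theta_feasible (R : realType) (n : nat) (e : rel 'I_n) :
    set 'M[R]_n :=
  [set B | [/\ psd B, \sum_x B x x = 1 & forall x y, e x y -> B x y = 0]].

(* The supremum below is a maximum: see [theta_max]. *)
Definition theta (R : realType) (n : nat) (e : rel 'I_n) : R :=
  sup [set \sum_x \sum_y B x y | B in @theta_feasible R n e].

Lemma circular_clique_sym k d : symmetric (@circular_clique k d).
Proof. by move=> i j; rewrite /circular_clique distnC. Qed.

Lemma circular_clique_irr k d : (0 < d)%N -> irreflexive (@circular_clique k d).
Proof. by move=> d0 i; rewrite /circular_clique distnn leqNgt d0. Qed.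

Lemma compl_graph_sym n (e : rel 'I_n) :
  symmetric e -> symmetric (compl_graph e).
Proof. by move=> se x y; rewrite /compl_graph eq_sym se. Qed.

Lemma compl_graph_irr n (e : rel 'I_n) : irreflexive (compl_graph e).
Proof. by move=> x; rewrite /compl_graph eqxx. Qed.

Section theta_max.
Variables (R : realType) (n : nat).
Implicit Type B : 'M[R]_n.

Let feasible_entry (e : rel 'I_n) B x y : theta_feasible e B -> `|B x y| <= 1.
Proof.
move=> [[Bsym Bpos] Btr _].
have dE p q : ((delta_mx p 0 : 'cV[R]_n)^T *m B *m (delta_mx q 0 : 'cV[R]_n)) 0 0
    = B p q.
  by rewrite trmx_delta -rowE -colE !mxE.
have diag_ge0 z : 0 <= B z z by rewrite -dE.
have diag_le1 z : B z z <= 1.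
  by rewrite -Btr (bigD1 z)//= lerDl sumr_ge0.
have Bxy : B y x = B x y by rewrite -[in RHS]Bsym mxE.
have E (a : R) : 0 <= B x x + a * B x y + (a * B x y + a * a * B y y).
  have := Bpos (delta_mx x 0 + a *: delta_mx y 0).
  have -> : (delta_mx x 0 + a *: delta_mx y 0 : 'cV[R]_n)^T
      = (delta_mx x 0)^T + a *: (delta_mx y 0)^T by apply/rowP => i; rewrite !mxE.
  rewrite !(mulmxDl, mulmxDr) -!(scalemxAl, scalemxAr).
  have addE (M N : 'M[R]_1) : (M + N) 0 0 = M 0 0 + N 0 0 by rewrite mxE.
  have mulE c (M : 'M[R]_1) : (c *: M) 0 0 = c * M 0 0 by rewrite mxE.
  by rewrite !(addE, mulE) !dE Bxy mulrA.
have := E 1; have := E (-1); have := diag_le1 x; have := diag_le1 y.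
by move=> *; rewrite ler_norml; apply/andP; split; lra.
Qed.

Let csum (T : topologicalType) m (g : 'I_m -> T -> R) :
  (forall i, continuous (g i)) -> continuous (fun v => \sum_i g i v).
Proof.
move=> cg; elim: (index_enum _) => [|i r IH].
  under eq_fun do rewrite big_nil.
  exact: cst_continuous.
under eq_fun do rewrite big_cons.
by move=> v; apply: cvgD; [exact: cg|exact: IH].
Qed.

Let cqform (T : topologicalType) (M : T -> 'M[R]_n) (u : 'cV[R]_n) :
  (forall x y, continuous (fun v => M v x y)) ->
  continuous (fun v => \sum_y (\sum_x u x 0 * M v x y) * u y 0).
Proof.
move=> cM; apply: csum => y v; apply: cvgM; last exact: cvg_cst.
apply: (csum (g := fun x w => u x 0 * M w x y)) => x w.
by apply: cvgM; [exact: cvg_cst|exact: cM].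
Qed.

Let qformE B (u : 'cV[R]_n) :
  (u^T *m B *m u) 0 0 = \sum_y (\sum_x u x 0 * B x y) * u y 0.
Proof.
rewrite mxE; apply: eq_bigr => y _; rewrite mxE; congr (_ * _).
by apply: eq_bigr => x _; rewrite mxE.
Qed.

Let csub (T : topologicalType) (g h : T -> R) :
  continuous g -> continuous h -> continuous (fun v => g v - h v).
Proof. by move=> cg ch v; apply: cvgB; [exact: cg|exact: ch]. Qed.

Lemma theta_max (e : rel 'I_n) : (0 < n)%N -> irreflexive e ->
  exists2 B, @theta_feasible R n e B & \sum_x \sum_y B x y = theta R e /\
    forall C, theta_feasible e C -> \sum_x \sum_y C x y <= theta R e.
Proof.
move=> n0 irr.
pose f (v : 'rV[R]_(n * n)) := \sum_x \sum_y (vec_mx v) x y.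
pose A := [set v : 'rV[R]_(n * n) | theta_feasible e (vec_mx v)].
have cc x y : continuous (fun v : 'rV[R]_(n * n) => vec_mx v x y).
  move=> v; rewrite (_ : (fun _ => _) = fun v : 'rV[R]_(n * n) => v 0 (mxvec_index x y)).
    exact: coord_continuous.
  by apply/funext => w; rewrite mxE.
have A0 : A !=set0.
  pose i0 := Ordinal n0; exists (mxvec (delta_mx i0 i0)); rewrite /A /= mxvecK.
  split.
  - split; first by rewrite trmx_delta.
    move=> v; rewrite -(mul_delta_mx (0 : 'I_1)) mulmxA -mulmxA.
    rewrite -[delta_mx 0 i0]trmxK trmx_delta -[v in X in _ <= (_ *m (_ *m X)) _ _]trmxK -trmx_mul.
    by rewrite mxE big_ord1 [X in _ * X]mxE -expr2 sqr_ge0.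
  - rewrite (bigD1 i0)//= big1 ?addr0 ?mxE ?eqxx// => i /negPf ii0.
    by rewrite mxE ii0.
  - move=> x y exy; rewrite mxE; case: eqP => //= xi; case: eqP => //= yi.
    by rewrite xi yi irr in exy.
have Aclosed : closed A.
  rewrite (_ : A = (\bigcap_(p : 'I_n * 'I_n) [set v | vec_mx v p.1 p.2 - vec_mx v p.2 p.1 = 0])
     `&` (\bigcap_(u : 'cV[R]_n)
       [set v | 0 <= \sum_y (\sum_x u x 0 * vec_mx v x y) * u y 0])
     `&` [set v | \sum_x vec_mx v x x = 1]
     `&` (\bigcap_(p in [set p : 'I_n * 'I_n | e p.1 p.2])
       [set v | vec_mx v p.1 p.2 = 0])); last first.
    apply/seteqP; split=> v /=.
      move=> [[sv pv] tv ev]; do ![split] => //.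
      - move=> [x y] _ /=; have /matrixP/(_ y x) := sv.
        by rewrite [_^T _ _]mxE => ->; rewrite subrr.
      - by move=> u _ /=; rewrite -qformE.
      - by move=> [x y] /=; exact: ev.
    move=> [[[sv pv] tv] ev]; split => //.
    - split; last by move=> u; rewrite qformE; exact: pv.
      by apply/matrixP => x y; rewrite [_^T _ _]mxE; apply/subr0_eq/(sv (y, x)).
    - by move=> x y exy; exact: (ev (x, y)).
  have cl0 (g : 'rV[R]_(n * n) -> R) c : continuous g -> closed [set v | g v = c].
    by move=> cg; apply: (@preimage_closed _ _ g [set c]); [move=> v _; exact: cg|exact: closed_eq].
  apply: closedI; last first.
    by apply: closed_bigI => p _; apply: cl0; exact: cc.
  apply: closedI; last by apply: cl0; apply: csum => i; exact: cc.
  apply: closedI.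
    by apply: closed_bigI => p _; apply: cl0; apply: csub; exact: cc.
  apply: closed_bigI => u _.
  apply: (@preimage_closed _ _ (fun v => \sum_y (\sum_x u x 0 * vec_mx v x y) * u y 0)
    [set r | 0 <= r]); last exact: closed_ge.
  by move=> v _; apply: cqform => x y; exact: cc.
have Abounded : bounded_set A.
  exists 1; split=> // M M1 v Av.
  rewrite /Num.norm/=; apply: le_trans (ltW M1).
  rewrite mx_normrE; apply: bigmax_le => // -[i p] _ /=.
  rewrite ord1; case/mxvec_indexP: p => x y.
  by have := feasible_entry x y Av; rewrite mxE.
have cf : {within A, continuous f}.
  apply: continuous_subspaceT; apply: csum => x; apply: csum => y; exact: cc.
have [v /set_mem Av vmax] :=
  compact_EVT_max A0 (bounded_closed_compact Abounded Aclosed) cf.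
have ub C : theta_feasible e C -> \sum_x \sum_y C x y <= f v.
  move=> eC; have := vmax (mxvec C); rewrite /f mxvecK; apply.
  by apply/mem_set; rewrite /A /= mxvecK.
have vE : f v = theta R e.
  apply/eqP; rewrite eq_le; apply/andP; split.
    apply: ub_le_sup; last by exists (vec_mx v).
    by exists (f v) => _ [C eC <-]; exact: ub.
  apply: ge_sup; first by exists (f v), (vec_mx v).
  by move=> _ [C eC <-]; exact: ub.
by exists (vec_mx v) => //; split=> // C /ub; rewrite vE.
Qed.
End theta_max.

(* Main.v *)
Require Import Defs.
From mathcomp Require Import all_boot all_order all_algebra.
From mathcomp Require Import all_classical all_reals all_analysis.
From mathcomp Require Import ring lra zify.

(* Upper bound: the k arcs of d cyclically consecutive vertices are cliques of the
   complement and cover every vertex d times. Evaluating a feasible B at the k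
   vectors 1 - (k/d) 1_A, A an arc, and summing gives theta <= k/d.

   Lower bound: a random frequency J in Z/k gives the positive semidefinite matrix
   f(x - y), f(s) = E cos(2 pi J s / k), with f(0) = 1 and entry sum k^2 P(J = 0).
   If the points n k / d were integers, J uniform on them would have f = 0 on
   0 < s < d and P(J = 0) = 1/d, which is the value k/d. In general the nth point,
   n <> 0, is replaced by a random integer with the same mean and with variance
   exactly 1/4. As the variance does not depend on n, the second order term of the
   Taylor expansion of f(s), 0 < s < d, is, up to sign, (z^2 / 8d) times the sum of
   cos(2 pi n s / d) over n <> 0, which is -1; here z = 2 pi s / k. Hence
   |f(s)| <= z^2 / 8d + z^3 / 16 =: eps. Deleting these entries and adding
   eta = 2 d eps to the diagonal preserves positivity by diagonal dominance, does not
   decrease the entry sum, and costs a factor 1 + eta in the trace. *)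

Import Order.TTheory GRing.Theory Num.Theory numFieldNormedType.Exports.

Set Implicit Arguments.
Unset Strict Implicit.
Unset Printing Implicit Defensive.

Local Open Scope classical_set_scope.
Local Open Scope ring_scope.

(** * Taylor bounds for the cosine, and cosine sums over arithmetic progressions *)

Section Trig.
Variable R : realType.
Implicit Types a b t : R.

Lemma ge0_of_derive_ge0 (f df : R -> R) t : (forall x : R, is_derive x 1 f (df x)) ->
  (forall x, 0 <= x -> 0 <= df x) -> f 0 = 0 -> 0 <= t -> 0 <= f t.
Proof.
move=> fD df0 f0 t0.
have fC : {within `[0, t], continuous f}.
  apply: continuous_subspaceT => x.
  by apply/differentiable_continuous/derivable1_diffP; apply: ex_derive.
have [x xt] := MVT_segment t0 (fun x _ => fD x) fC.
rewrite f0 !subr0 => ->; rewrite mulr_ge0// df0//.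
by move: xt; rewrite in_itv/= => /andP[].
Qed.

(** Both [f + g] and [g - f] vanish at 0 and have nonnegative derivative on the half-line. Each
    Taylor bound below is integrated from the preceding one in this way. *)
Lemma norm_le_of_derive (f df g dg : R -> R) t :
  (forall x : R, is_derive x 1 f (df x)) -> (forall x : R, is_derive x 1 g (dg x)) ->
  (forall x, 0 <= x -> `|df x| <= dg x) -> f 0 = 0 -> g 0 = 0 ->
  0 <= t -> `|f t| <= g t.
Proof.
move=> fD gD fg f0 g0 t0; rewrite ler_norml; apply/andP; split.
  rewrite -subr_ge0 opprK.
  apply: (@ge0_of_derive_ge0 (f + g) (fun x => df x + dg x)) => //=.
    by move=> x /fg; rewrite ler_norml; lra.
  by rewrite /GRing.add /= f0 g0 addr0.
rewrite -subr_ge0.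
apply: (@ge0_of_derive_ge0 (g - f) (fun x => dg x - df x)) => //=.
  by move=> x /fg; rewrite ler_norml; lra.
by rewrite /GRing.add /= /GRing.opp /= f0 g0 subr0.
Qed.

Lemma cos_taylor1 a t : 0 <= t -> `|cos (a + t) - cos a| <= t.
Proof.
have fD (x : R) : is_derive x 1 (fun y => cos (a + y) - cos a) (- sin (a + x)).
  by apply: is_derive_eq; rewrite /GRing.scale /=; ring.
apply: (norm_le_of_derive fD (dg := fun=> 1)).
- by move=> x _; rewrite normrN sin_max.
- by rewrite addr0 subrr.
- by [].
Qed.

Lemma cos_taylor2 a t : 0 <= t ->
  `|cos (a + t) - cos a + t * sin a| <= t ^+ 2 / 2.
Proof.
have fD (x : R) : is_derive x 1 (fun y => cos (a + y) - cos a + y * sin a)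
    (- sin (a + x) + sin a).
  by apply: is_derive_eq; rewrite /GRing.scale /=; ring.
have gD (x : R) : is_derive x 1 (fun y : R => y ^+ 2 / 2) x.
  by apply: is_derive_eq; rewrite /GRing.scale /=; field.
apply: (norm_le_of_derive fD gD).
(* The derivative is the remainder of the previous order, taken at [a + pi / 2]. *)
- move=> x x0; have := cos_taylor1 (a + pi / 2) x0.
  by rewrite addrAC !cosDpihalf opprK.
- by rewrite addr0 subrr mul0r addr0.
- by rewrite expr0n mul0r.
Qed.

Lemma cos_taylor3_ge0 a t : 0 <= t ->
  `|cos (a + t) - (cos a - t * sin a - t ^+ 2 / 2 * cos a)| <= t ^+ 3 / 6.
Proof.
have fD (x : R) : is_derive x 1
    (fun y => cos (a + y) - (cos a - y * sin a - y ^+ 2 / 2 * cos a))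
    (- sin (a + x) + sin a + x * cos a).
  by apply: is_derive_eq; rewrite /GRing.scale /=; field.
have gD (x : R) : is_derive x 1 (fun y : R => y ^+ 3 / 6) (x ^+ 2 / 2).
  by apply: is_derive_eq; rewrite /GRing.scale /=; field.
apply: (norm_le_of_derive fD gD).
- move=> x x0; have := cos_taylor2 (a + pi / 2) x0.
  by rewrite (addrAC a) !cosDpihalf sinDpihalf opprK.
- by rewrite addr0; ring.
- by rewrite expr0n mul0r.
Qed.

Lemma cos_taylor3 a t :
  `|cos (a + t) - (cos a - t * sin a - t ^+ 2 / 2 * cos a)| <= `|t| ^+ 3 / 6.
Proof.
have [t0|t0] := leP 0 t; first by rewrite (ger0_norm t0) ?cos_taylor3_ge0.
have := @cos_taylor3_ge0 (- a) (- t).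
rewrite oppr_ge0 (ltW t0) -opprD !cosN sinN mulrNN sqrrN (ltr0_norm t0).
exact.
Qed.

(** Multiplication by [sin (a / 2)], nonzero as 0 < a / 2 < pi, makes the sum telescope; its two
    ends differ by [x] full periods. *)
Lemma sum_cos_progression (n x : nat) b : (0 < x < n)%N ->
  \sum_(i < n) cos (b + 2 * pi * x%:R / n%:R * i%:R) = 0.
Proof.
move=> /andP[x0 xn]; set a := _ / _.
have n0 : (0 : R) < n%:R by rewrite ltr0n; lia.
have sa : sin (a / 2) != 0.
  have -> : a / 2 = pi * (x%:R / n%:R) by rewrite /a; field; rewrite lt0r_neq0.
  apply/lt0r_neq0/sin_gt0_pi.
  rewrite mulr_gt0 ?divr_gt0 ?pi_gt0 ?ltr0n ?(leq_trans x0 (ltnW xn))//=.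
  by rewrite gtr_pMr ?pi_gt0// ltr_pdivrMr// mul1r ltr_nat.
apply: (mulfI sa); rewrite mulr0 mulr_sumr.
under eq_bigr => i _.
  have -> : sin (a / 2) * cos (b + a * i%:R) =
     sin (b + a * i.+1%:R - a / 2) / 2 - sin (b + a * i%:R - a / 2) / 2.
    have -> : b + a * i.+1%:R - a / 2 = (b + a * i%:R) + a / 2 by rewrite -natr1; field.
    by rewrite sinD sinB; field.
  over.
rewrite -(big_mkord xpredT (fun i => sin (b + a * i.+1%:R - a / 2) / 2 - sin (b + a * i%:R - a / 2) / 2)).
rewrite telescope_sumr//.
have -> : b + a * n%:R - a / 2 = b + a * 0 - a / 2 + (pi *+ 2) *+ x.
  by rewrite /a -[pi *+ 2]mulr_natr -[(pi * 2) *+ x]mulr_natr; field; rewrite lt0r_neq0.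
by rewrite (periodicn (@sinD2pi R)) subrr.
Qed.
End Trig.

(** * Arcs of cyclically consecutive vertices *)

Lemma sum_arc (k d a : nat) : (d <= k)%N -> (\sum_(j < k) ((j + a) %% k < d) = d)%N.
Proof.
case: k => [|k'] dk; first by rewrite big_ord0; lia.
rewrite (reindex_inj (addIr (- inZp a : 'I_k'.+1))) /=.
under eq_bigr => j _.
  rewrite (_ : (_ %% _)%N = j :> nat); first over.
  by rewrite -(modnDmr _ a); exact: (congr1 val (subrK (inZp a) j)).
(* The minimum makes the count valid for every range, as the induction requires. *)
transitivity (minn k'.+1 d); last by lia.
elim: k'.+1 => [|n IH]; first by rewrite big_ord0 min0n.
by rewrite big_ord_recr /= IH; lia.
Qed.

Section Arcs.
Variables (k d : nat).

Lemma modn_lt2 m : (m < 2 * k)%N -> (m %% k = if m < k then m else m - k)%N.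
Proof.
case: (ltnP m k) => mk m2; first by rewrite modn_small.
have mkk : (m - k < k)%N by lia.
by rewrite -{1}(subnK mk) modnDr modn_small.
Qed.

Lemma compl_circular_clique_arc i (x y : 'I_k) : (2 * d <= k)%N -> (i < k)%N ->
  ((x + i) %% k < d)%N -> ((y + i) %% k < d)%N -> x != y ->
  compl_graph (@circular_clique k d) x y.
Proof.
move=> dk ik; have := ltn_ord x; have := ltn_ord y.
rewrite /compl_graph /circular_clique -val_eqE /= => yk xk.
rewrite !modn_lt2; [|lia|lia].
move=> + + ->; case: (ltnP (x + i) k) => xi; case: (ltnP (y + i) k) => yi /=; lia.
Qed.

(** Neighbours of [x] lie in the arc from x - d + 1 to x + d - 1; the shift moves its first vertex
    to 0. *)
Lemma compl_circular_clique_near (x y : 'I_k) : (2 * d <= k)%N ->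
  compl_graph (@circular_clique k d) x y ->
  ((y + (k - x + d.-1)) %% k < (2 * d).-1)%N.
Proof.
move=> dk; have := ltn_ord x; have := ltn_ord y.
rewrite /compl_graph /circular_clique -val_eqE /= => yk xk xy.
have [yx|yx] := ltnP (y + d.-1) x.
  by rewrite modn_small; lia.
have -> : (y + (k - x + d.-1) = y + d.-1 - x + k)%N by lia.
rewrite modnDr modn_lt2; last by lia.
by case: (ltnP (y + d.-1 - x) k); lia.
Qed.

Lemma compl_circular_clique_degree (x : 'I_k) : (2 * d <= k)%N ->
  (\sum_(y < k) compl_graph (@circular_clique k d) x y <= 2 * d)%N.
Proof.
move=> dk; apply: (@leq_trans (2 * d).-1); last by lia.
rewrite -[leqRHS](@sum_arc k (2 * d).-1 (k - x + d.-1)); last by lia.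
apply: leq_sum => y _.
by case: (boolP (compl_graph _ _ _)) => // /(compl_circular_clique_near dk) ->.
Qed.
End Arcs.

(** * Quadratic forms *)

Section QForm.
Variables (R : realType) (n : nat).
Implicit Types (B : 'M[R]_n) (v : 'I_n -> R).

Lemma col_qformE B (w : 'cV[R]_n) :
  (w^T *m B *m w) 0 0 = \sum_x \sum_y w x 0 * w y 0 * B x y.
Proof.
rewrite mxE exchange_big /=; apply: eq_bigr => y _.
rewrite mxE mulr_suml; apply: eq_bigr => x _.
by rewrite mxE; ring.
Qed.

Lemma psd_qform_ge0 B v : psd B -> 0 <= \sum_x \sum_y v x * v y * B x y.
Proof.
move=> [_ /(_ (\col_x v x))]; rewrite col_qformE.
by under eq_bigr => x _ do under eq_bigr => y _ do rewrite !mxE.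
Qed.

(** By the addition formula the form is a sum of two squares. *)
Lemma cos_qform_ge0 (a : 'I_n -> R) v :
  0 <= \sum_x \sum_y v x * v y * cos (a x - a y).
Proof.
suff -> : \sum_x \sum_y v x * v y * cos (a x - a y) =
    (\sum_x v x * cos (a x)) ^+ 2 + (\sum_x v x * sin (a x)) ^+ 2.
  by rewrite addr_ge0 ?sqr_ge0.
rewrite !expr2 !mulr_suml -big_split/=; apply: eq_bigr => x _.
rewrite !mulr_sumr -big_split/=; apply: eq_bigr => y _.
by rewrite cosB; ring.
Qed.
End QForm.

(** * The upper bound k/d *)

Section Upper.
Variables (R : realType) (k d : nat).
Hypotheses (d0 : (0 < d)%N) (dk : (2 * d <= k)%N).
Let e := compl_graph (@circular_clique k d).

Lemma feasible_circular_clique_le (B : 'M[R]_k) : theta_feasible e B ->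
  \sum_x \sum_y B x y <= k%:R / d%:R.
Proof.
move=> [Bpsd Btr B0].
have k0 : (0 : R) < k%:R by rewrite ltr0n; lia.
have dR0 : (0 : R) < d%:R by rewrite ltr0n.
pose c : R := k%:R / d%:R.
pose chi (i x : 'I_k) : R := ((x + i) %% k < d)%N%:R.
have sum_chi x : \sum_i chi i x = d%:R.
  rewrite /chi -natr_sum; congr _%:R.
  by under eq_bigr do rewrite addnC; apply: sum_arc; lia.
(* An arc is a clique, so [B] restricted to it is diagonal. *)
have chiB i x y : chi i x * chi i y * B x y = (x == y)%:R * chi i x * B x y.
  have [->|xy] := eqVneq x y.
    by rewrite mul1r /chi; case: (_ < _)%N; rewrite ?mulr1 ?mul0r.
  rewrite !mul0r /chi; case: ltnP => xi; last by rewrite !mul0r.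
  case: ltnP => yi; last by rewrite mulr0 mul0r.
  by rewrite B0 ?mulr0//; apply: (compl_circular_clique_arc (i := i)).
have: 0 <= \sum_i \sum_x \sum_y (1 - c * chi i x) * (1 - c * chi i y) * B x y.
  by apply: sumr_ge0 => i _; exact: psd_qform_ge0.
rewrite exchange_big /=.
under eq_bigr => x _.
  rewrite exchange_big /=.
  under eq_bigr => y _.
    (* Every vertex lies in [d] arcs and c d = k, so the constant and linear terms give k - 2k =
       -k. *)
    have -> : \sum_(i < k) (1 - c * chi i x) * (1 - c * chi i y) * B x y =
        - (k%:R * B x y) + (x == y)%:R * (c ^+ 2 * d%:R * B x y).
      transitivity (\sum_(i < k) (B x y - c * chi i x * B x y - c * chi i y * B x y
         + c ^+ 2 * ((x == y)%:R * chi i x * B x y))).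
        by apply: eq_bigr => i _; rewrite -chiB; ring.
      rewrite !big_split /= !sumrN sumr_const card_ord -mulr_natl.
      rewrite -!mulr_sumr -!mulr_suml -!mulr_sumr !sum_chi /c.
      by field; rewrite lt0r_neq0.
    over.
  rewrite big_split /= sumrN -mulr_sumr.
  rewrite [X in _ + X](_ : _ = c ^+ 2 * d%:R * B x x); first over.
  rewrite (bigD1 x)//= eqxx mul1r big1 ?addr0// => y yx.
  by rewrite eq_sym (negPf yx) mul0r.
rewrite big_split /= sumrN -!mulr_sumr Btr mulr1.
rewrite addrC subr_ge0 => h; rewrite -(ler_pM2l k0); apply: le_trans h _.
by rewrite /c le_eqVlt; apply/orP; left; apply/eqP; field; rewrite lt0r_neq0.
Qed.
End Upper.

(** * A lower bound from a random frequency with small cosine means *)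

Section Lower.
Variables (R : realType) (k d : nat).
Hypotheses (d0 : (0 < d)%N) (dk : (2 * d <= k)%N).
Let e := compl_graph (@circular_clique k d).
Variables (T : finType) (q : T -> R) (nu : T -> nat) (eps : R).
Hypotheses (q0 : forall t, 0 <= q t) (q1 : \sum_t q t = 1).
Let f (s : R) := \sum_t q t * cos (2 * pi * (nu t)%:R / k%:R * s).
Hypotheses (eps0 : 0 <= eps)
  (feps : forall x : nat, (0 < x < d)%N -> `|f x%:R| <= eps).

(** The degree bound [2 * d] times the bound [eps] on the deleted entries. *)
Let eta := 2 * d%:R * eps.
Let g (x y : 'I_k) : R := (x == y)%:R * eta - (e x y)%:R * f (x%:R - y%:R).
Let B : 'M[R]_k :=
  \matrix_(x, y) ((k%:R * (1 + eta))^-1 * (f (x%:R - y%:R) + g x y)).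

Let kR0 : (0 : R) < k%:R. Proof. by rewrite ltr0n; lia. Qed.
Let eta0 : 0 <= eta. Proof. by rewrite !mulr_ge0. Qed.
Let c0 : 0 < (k%:R * (1 + eta))^-1.
Proof. by rewrite invr_gt0 mulr_gt0// ltr_wpDr. Qed.

Let fN s : f (- s) = f s.
Proof. by apply: eq_bigr => t _; rewrite mulrN cosN. Qed.

(** Integer frequencies give [f] the period k. With evenness this reduces pairs at distance above k
    - d to distances below d. *)
Let f_sub s : f (k%:R - s) = f s.
Proof.
apply: eq_bigr => t _; congr (_ * _).
rewrite (_ : _ * _ = - (2 * pi * (nu t)%:R / k%:R * s) + (pi *+ 2) *+ nu t).
  by rewrite (periodicn (@cosD2pi R)) cosN.
by rewrite -[pi *+ 2]mulr_natr -[(pi * 2) *+ _]mulr_natr; field; rewrite lt0r_neq0.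
Qed.

Let e_sym : symmetric e.
Proof. exact: compl_graph_sym (@circular_clique_sym k d). Qed.

Let f_edge x y : e x y -> `|f (x%:R - y%:R)| <= eps.
Proof.
wlog yx : x y / (y <= x)%N.
  move=> H xy; case: (leqP y x) => [/H|/ltnW/H]; first exact.
  by rewrite -opprB fN; apply; rewrite e_sym.
rewrite /e /compl_graph /circular_clique -val_eqE /= => xy.
rewrite -natrB//; have xk := ltn_ord x.
have [xyd|xyd] := ltnP (x - y) d; first by apply: feps; lia.
by rewrite -f_sub -natrB; [apply: feps|]; lia.
Qed.

Let g_qform_ge0 (v : 'I_k -> R) : 0 <= \sum_x \sum_y v x * v y * g x y.
Proof.
(* |v_x v_y F| <= eps (v_x^2 + v_y^2) / 2 for |F| <= eps. *)
have vg x y : (x == y)%:R * (eta * v x ^+ 2) - eps / 2 * v x ^+ 2 * (e x y)%:R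
    - eps / 2 * v y ^+ 2 * (e y x)%:R <= v x * v y * g x y.
  rewrite (e_sym y) /g mulrBr -subr_ge0.
  have -> : v x * v y * ((x == y)%:R * eta) = (x == y)%:R * (eta * v x ^+ 2).
    by case: eqVneq => [->|_] /=; ring.
  have [exy|_] := boolP (e x y); last first.
    by rewrite !(mulr0, mul0r, subr0) subrr.
  rewrite !mul1r !mulr1.
  have := f_edge exy; rewrite ler_norml => /andP[f1 f2].
  set F := f _ in f1 f2 *.
  have h1 : 0 <= (eps - F) * (v x + v y) ^+ 2 by rewrite mulr_ge0 ?subr_ge0 ?sqr_ge0.
  have h2 : 0 <= (eps + F) * (v x - v y) ^+ 2 by rewrite mulr_ge0 ?sqr_ge0//; lra.
  have -> : (x == y)%:R * (eta * v x ^+ 2) - v x * v y * F -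
     ((x == y)%:R * (eta * v x ^+ 2) - eps / 2 * v x ^+ 2 - eps / 2 * v y ^+ 2) =
     ((eps - F) * (v x + v y) ^+ 2 + (eps + F) * (v x - v y) ^+ 2) / 4 by field.
  by rewrite divr_ge0// addr_ge0.
have deg x : \sum_y (e x y)%:R <= 2 * d%:R :> R.
  rewrite -natr_sum -[2 * _]natrM ler_nat; exact: compl_circular_clique_degree.
apply: (@le_trans _ _ (\sum_x \sum_y ((x == y)%:R * (eta * v x ^+ 2)
    - eps / 2 * v x ^+ 2 * (e x y)%:R - eps / 2 * v y ^+ 2 * (e y x)%:R))); last first.
  by apply: ler_sum => x _; apply: ler_sum => y _; exact: vg.
under eq_bigr do rewrite !big_split /= !sumrN.
rewrite !big_split /= !sumrN.
(* After the exchange the two edge sums coincide, which is why the second one was written with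
   [e y x]. *)
rewrite [X in _ - X](exchange_big) /=.
under eq_bigr => x _.
  rewrite (bigD1 x)//= eqxx mul1r big1; last first.
    by move=> y yx; rewrite eq_sym (negPf yx) mul0r.
  over.
rewrite -addrA -opprD -mulr2n subr_ge0 -sumrMnl.
apply: ler_sum => x _; rewrite addr0 -mulr_sumr /eta.
have := ler_wpM2l (mulr_ge0 eps0 (sqr_ge0 (v x))) (deg x).
set S := \sum_(y < k) _ => h.
rewrite mulr2n (_ : _ + _ = eps * v x ^+ 2 * S); last by field.
by apply: le_trans h _; rewrite le_eqVlt; apply/orP; left; apply/eqP; ring.
Qed.

Let f_qformE (v : 'I_k -> R) : \sum_x \sum_y v x * v y * f (x%:R - y%:R) =
  \sum_t q t * \sum_x \sum_y v x * v y *
     cos (2 * pi * (nu t)%:R / k%:R * x%:R - 2 * pi * (nu t)%:R / k%:R * y%:R).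
Proof.
under eq_bigr => x _.
  under eq_bigr do rewrite /f mulr_sumr.
  rewrite exchange_big /=; over.
rewrite exchange_big /=; apply: eq_bigr => t _.
rewrite mulr_sumr; apply: eq_bigr => x _; rewrite mulr_sumr; apply: eq_bigr => y _.
by rewrite mulrBr mulrCA.
Qed.

Let B_feasible : theta_feasible e B.
Proof.
split.
- split.
    apply/matrixP => x y; rewrite !mxE /g -opprB fN eq_sym.
    by congr (_ * (_ + (_ - _%:R * _))); rewrite e_sym.
  move=> w; rewrite col_qformE.
  rewrite (_ : \sum_x _ = (k%:R * (1 + eta))^-1 *
     (\sum_x \sum_y w x 0 * w y 0 * f (x%:R - y%:R) + \sum_x \sum_y w x 0 * w y 0 * g x y)).
    apply: mulr_ge0; first exact: ltW c0.
    apply: addr_ge0; last exact: (g_qform_ge0 (fun x => w x 0)).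
    rewrite (f_qformE (fun x => w x 0)).
    apply: sumr_ge0 => t _; rewrite mulr_ge0//.
    exact: (cos_qform_ge0 (fun x : 'I_k => 2 * pi * (nu t)%:R / k%:R * x%:R) (fun x => w x 0)).
  rewrite -big_split mulr_sumr /=; apply: eq_bigr => x _.
  rewrite -big_split mulr_sumr /=; apply: eq_bigr => y _.
  by rewrite mxE; ring.
- have f0 : f 0 = 1 by rewrite /f -[RHS]q1; apply: eq_bigr => t _; rewrite mulr0 cos0 mulr1.
  under eq_bigr => x _.
    rewrite mxE subrr f0 /g eqxx [e x x]compl_graph_irr mul0r subr0 mul1r; over.
  rewrite sumr_const card_ord -mulr_natl.
  by field; rewrite !lt0r_neq0// ltr_wpDr.
- move=> x y exy; rewrite mxE /g exy mul1r; case: eqVneq exy => [->|_ _].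
    by rewrite /e compl_graph_irr.
  by rewrite mul0r sub0r subrr mulr0.
Qed.

(** In the entry sum of [B], before normalization, frequency 0 contributes k^2 times its weight;
    every other frequency and the correction [g] contribute nonnegative amounts. *)
Lemma theta_ge_of_weights :
  k%:R * (\sum_(t | nu t == 0) q t) / (1 + eta) <= theta R e.
Proof.
have kN : (0 < k)%N by lia.
have [_ _ [_ H]] := @theta_max R k e kN (@compl_graph_irr _ _).
apply: le_trans (H _ B_feasible).
have -> : \sum_(x < k) \sum_(y < k) B x y = (k%:R * (1 + eta))^-1 *
     (\sum_(x < k) \sum_(y < k) 1 * 1 * f (x%:R - y%:R) + \sum_x \sum_y 1 * 1 * g x y).
  rewrite -big_split mulr_sumr /=; apply: eq_bigr => x _.
  rewrite -big_split mulr_sumr /=; apply: eq_bigr => y _.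
  by rewrite mxE; ring.
rewrite (f_qformE (fun=> 1)).
have -> : k%:R * (\sum_(t | nu t == 0) q t) / (1 + eta) =
   (k%:R * (1 + eta))^-1 * (k%:R ^+ 2 * \sum_(t | nu t == 0) q t).
  by field; rewrite !lt0r_neq0// ltr_wpDr.
rewrite (ler_pM2l c0) -[leLHS]addr0; apply: lerD; last exact: (g_qform_ge0 (fun=> 1)).
rewrite mulr_sumr big_mkcond /=; apply: ler_sum => t _.
case: eqP => [->|_]; last first.
  rewrite mulr_ge0//.
  exact: (cos_qform_ge0 (fun x : 'I_k => 2 * pi * (nu t)%:R / k%:R * x%:R) (fun=> 1)).
rewrite mulrC ler_wpM2l//.
under eq_bigr do under eq_bigr do rewrite mulr0 !mul0r subrr cos0 !mulr1.
by under eq_bigr do rewrite sumr_const card_ord; rewrite sumr_const card_ord expr2 -[leRHS]mulr_natr.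
Qed.
End Lower.

(** * Random rounding with variance 1/4 *)

Section Rounding.
Variable R : realType.

(* The values at phi + 1, phi, phi - 1 of the quadratic B-spline: the weights that
   the integers -1, 0, 1 receive; their mean is phi and their variance 1/4. *)
Definition spline (phi : R) (s : 'I_3) : R :=
  nth 0 [:: (1 / 2 - phi) ^+ 2 / 2; 3 / 4 - phi ^+ 2; (1 / 2 + phi) ^+ 2 / 2] s.

Lemma sum3 (F : 'I_3 -> R) :
  \sum_s F s = F ord0 + F (lift ord0 ord0) + F ord_max.
Proof.
rewrite !big_ord_recl big_ord0 addr0 addrA; congr (_ + _ + F _).
exact: val_inj.
Qed.

Lemma spline_ge0 phi s : `|phi| <= 1 / 2 -> 0 <= spline phi s.
Proof.
rewrite ler_norml => /andP[h1 h2]; rewrite /spline.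
case: s => [[|[|[|//]]] /= _]; rewrite ?divr_ge0 ?sqr_ge0//.
nra.
Qed.

Lemma sum_spline phi : \sum_s spline phi s = 1.
Proof. by rewrite sum3 /spline /=; field. Qed.

(** The offset s - 1 - phi has mean 0 and variance 1/4, so the quadratic Taylor polynomial averages
    exactly to the stated main term. *)
Lemma spline_cos a z phi : 0 <= z -> `|phi| <= 1 / 2 ->
  `|\sum_s spline phi s * cos (a + z * (s%:R - 1 - phi))
    - cos a * (1 - z ^+ 2 / 8)| <= z ^+ 3 / 16.
Proof.
move=> z0 hphi.
pose P (t : R) := cos a - t * sin a - t ^+ 2 / 2 * cos a.
have -> : cos a * (1 - z ^+ 2 / 8) =
    \sum_s spline phi s * P (z * (s%:R - 1 - phi)).
  by rewrite sum3 /spline /P /= /bump /=; field.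
rewrite -sumrB; under eq_bigr do rewrite -mulrBr.
apply: le_trans (ler_norm_sum _ _ _) _.
(* The offset is at most 3/2 in absolute value, so its cube is at most 3/2 times its square;
   averaging gives (3/2)(1/4)/6 = 1/16. *)
have -> : z ^+ 3 / 16 =
    \sum_s spline phi s * ((3 / 2 * z) * (z * (s%:R - 1 - phi)) ^+ 2 / 6).
  by rewrite sum3 /spline /= /bump /=; field.
apply: ler_sum => s _; rewrite normrM (ger0_norm (spline_ge0 s hphi)).
rewrite ler_wpM2l ?spline_ge0//; apply: le_trans (cos_taylor3 _ _) _.
rewrite ler_pM2r ?invr_gt0// exprS real_normK ?num_real// ler_wpM2r ?sqr_ge0//.
rewrite normrM (ger0_norm z0) mulrC ler_wpM2r//.
move: hphi; rewrite !ler_norml => /andP[h1 h2].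
by case: s => [[|[|[|//]]] /= _]; apply/andP; split; lra.
Qed.
End Rounding.

(** * The weights on frequencies near the multiples of k/d *)

Section Weights.
Variables (R : realType) (k d' : nat).
Let d := d'.+1.
Hypothesis dk : (2 * d <= k)%N.

(* The integer nearest to n k / d. *)
Let j (n : nat) := ((2 * n * k + d) %/ (2 * d))%N.
Let phi (n : nat) : R := n%:R * k%:R / d%:R - (j n)%:R.
Let kR0 : (0 : R) < k%:R. Proof. by rewrite ltr0n; lia. Qed.
Let dR0 : (0 : R) < d%:R. Proof. by rewrite ltr0n. Qed.

Let phi_le n : `|phi n| <= 1 / 2.
Proof.
have h1 : (j n * (2 * d) <= 2 * n * k + d)%N by exact: leq_trunc_div.
have h2 : (2 * n * k + d < (j n).+1 * (2 * d))%N by rewrite -ltn_divLR.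
have e1 : (j n)%:R * (2 * d%:R) <= 2 * n%:R * k%:R + d%:R :> R.
  by rewrite -!(natrM, natrD) ler_nat.
have e2 : 2 * n%:R * k%:R + d%:R <= ((j n)%:R + 1) * (2 * d%:R) :> R.
  by rewrite natr1 -!(natrM, natrD) ler_nat ltnW.
have -> : phi n = (n%:R * k%:R - (j n)%:R * d%:R) / d%:R.
  by rewrite /phi; field; rewrite lt0r_neq0.
by rewrite ler_norml ler_pdivlMr// ler_pdivrMr//; apply/andP; split; lra.
Qed.

(** Ensures that the predecessor in [nu] is not truncated for n > 0. *)
Let j_gt0 n : (0 < n)%N -> (0 < j n)%N.
Proof. by move=> n0; rewrite divn_gt0//; move: dk; rewrite /d; nia. Qed.

(* (n, s) stands for the frequency j n + s - 1; the truncation in nu only affects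
   (0, 0), which has weight 0. *)
Let q (t : 'I_d * 'I_3) : R :=
  (if t.1 == 0 then (t.2 == 1)%:R else spline (phi t.1) t.2) / d%:R.
Let nu (t : 'I_d * 'I_3) : nat := (j t.1 + t.2).-1.

Let q_ge0 t : 0 <= q t.
Proof.
by rewrite divr_ge0 ?(ltW dR0)//; case: ifP => // _; exact: spline_ge0.
Qed.

Let sum_q : \sum_t q t = 1.
Proof.
rewrite -(pair_bigA _ (fun n s => q (n, s))) /=.
transitivity (\sum_(n < d) (d%:R^-1 : R)); last first.
  by rewrite sumr_const card_ord -[LHS]mulr_natr mulVf// lt0r_neq0.
apply: eq_bigr => n _; rewrite /q -mulr_suml /=.
case: (n == 0); last by rewrite sum_spline mul1r.
by rewrite sum3 /= add0r addr0 mul1r.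
Qed.

Let z (x : nat) : R := 2 * pi * x%:R / k%:R.

Let f_le x : (0 < x < d)%N ->
  `|\sum_t q t * cos (2 * pi * (nu t)%:R / k%:R * x%:R)| <=
    z d ^+ 2 / (8 * d%:R) + z d ^+ 3 / 16.
Proof.
move=> xd; have := sum_cos_progression (0 : R) xd.
set a := 2 * pi * x%:R / d%:R.
have z0 : 0 <= z x by rewrite divr_ge0 ?mulr_ge0 ?pi_ge0.
have zd : z x <= z d.
  rewrite /z ler_pM2r ?invr_gt0// ler_wpM2l ?mulr_ge0 ?pi_ge0// ler_nat; lia.
rewrite big_ord_recl /= mulr0 addr0 cos0 => /eqP; rewrite addrC addr_eq0 => /eqP sum_cos.
rewrite -(pair_bigA _ (fun n s => q (n, s) * cos (2 * pi * (nu (n, s))%:R / k%:R * x%:R))) /=.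
rewrite big_ord_recl sum3 /q /=.
rewrite !mul0r addr0 add0r mul1r.
have -> : nu (ord0, lift ord0 ord0) = 0%N.
  by rewrite /nu /j /= muln0 mul0n add0n divn_small//; lia.
rewrite mulr0 !mul0r cos0 mulr1.
(* Since j n = n k / d - phi n, the angle of frequency j n + s - 1 splits into [a] n and a small
   multiple of [z x]. *)
pose E (n : 'I_d') := \sum_s spline (phi n.+1) s *
    cos (0 + a * n.+1%:R + z x * (s%:R - 1 - phi n.+1)).
rewrite (eq_bigr (fun n => d%:R^-1 * E n)); last first.
  move=> n _; rewrite mulr_sumr; apply: eq_bigr => s _.
  rewrite mulrAC mulrC; congr (_ * (_ * cos _)).
  have jn : (0 < j n.+1)%N by exact: j_gt0.
  have -> : nu (lift ord0 n, s) = (j n.+1 + s - 1)%N by rewrite subn1.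
  rewrite natrB ?natrD; last by lia.
  by rewrite /phi /a /z; field; rewrite !lt0r_neq0.
rewrite -mulr_sumr -[X in X + _]mulr1 -mulrDr.
(* The cosines over n > 0 sum to -1, so the main terms give 1 - (1 - z^2/8) = z^2/8. *)
have -> : 1 + \sum_(n < d') E n = z x ^+ 2 / 8 +
    \sum_(n < d') (E n - cos (0 + a * n.+1%:R) * (1 - z x ^+ 2 / 8)).
  by rewrite sumrB -mulr_suml sum_cos; ring.
have errle : `|\sum_(n < d') (E n - cos (0 + a * n.+1%:R) * (1 - z x ^+ 2 / 8))|
    <= d%:R * (z x ^+ 3 / 16).
  apply: le_trans (ler_norm_sum _ _ _) _.
  apply: (@le_trans _ _ (\sum_(n < d') z x ^+ 3 / 16)).
    by apply: ler_sum => n _; apply: spline_cos => //; exact: phi_le.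
  rewrite sumr_const card_ord -[leLHS]mulr_natl ler_wpM2r ?divr_ge0 ?exprn_ge0//.
  by rewrite ler_nat.
rewrite normrM ger0_norm ?invr_ge0 ?(ltW dR0)// mulrC ler_pdivrMr//.
have z2 : z x ^+ 2 <= z d ^+ 2 by rewrite ler_pXn2r// nnegrE (le_trans z0).
have z3 : z x ^+ 3 <= z d ^+ 3 by rewrite ler_pXn2r// nnegrE (le_trans z0).
apply: le_trans (ler_normD _ _) _.
rewrite ger0_norm ?divr_ge0 ?sqr_ge0// mulrDl; apply: lerD.
  rewrite (_ : z d ^+ 2 / (8 * d%:R) * d%:R = z d ^+ 2 / 8).
    by rewrite ler_pM2r ?invr_gt0.
  by field; rewrite lt0r_neq0.
by apply: le_trans errle _; rewrite mulrC ler_pM2r// ler_pM2r ?invr_gt0.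
Qed.

Lemma theta_ge_spline : k%:R / d%:R / (1 + 2 * d%:R * (z d ^+ 2 / (8 * d%:R) + z d ^+ 3 / 16))
   <= theta R (compl_graph (@circular_clique k d)).
Proof.
have z0 : 0 <= z d by rewrite divr_ge0 ?mulr_ge0 ?pi_ge0.
have eps0 : 0 <= z d ^+ 2 / (8 * d%:R) + z d ^+ 3 / 16.
  by rewrite addr_ge0// divr_ge0 ?exprn_ge0.
apply: le_trans (theta_ge_of_weights _ dk q_ge0 sum_q eps0 f_le) => //.
rewrite ler_pM2r ?invr_gt0 ?ltr_wpDr// ?mulr_ge0// ler_pM2l//.
(* The index (0, 1) has frequency 0 and weight 1/d. *)
rewrite (bigD1 (ord0, lift ord0 ord0))/=; last first.
  by rewrite /nu /j /= muln0 mul0n add0n divn_small//; lia.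
by rewrite {1}/q /= mul1r lerDl sumr_ge0.
Qed.
End Weights.

(** * Explicit two-sided bounds and the asymptotics *)

Section Bounds.
Variables (R : realType) (k d : nat).
Hypotheses (d0 : (0 < d)%N) (dk : (2 * d <= k)%N).

Lemma theta_circular_clique_le :
  theta R (compl_graph (@circular_clique k d)) <= k%:R / d%:R.
Proof.
have kN : (0 < k)%N by lia.
have [B Bf [<- _]] := @theta_max R k _ kN (compl_graph_irr (@circular_clique k d)).
exact: feasible_circular_clique_le.
Qed.

(** From 1/(1 + eta) >= 1 - eta; the subtracted term is (k/d) eta, with [z d] = 2 pi d/k. *)
Lemma theta_circular_clique_ge :
  k%:R / d%:R - pi ^+ 2 * (d%:R / k%:R) * (1 + pi * d%:R ^+ 2 / k%:R)
    <= theta R (compl_graph (@circular_clique k d)).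
Proof.
have kR0 : (0 : R) < k%:R by rewrite ltr0n; lia.
have dR0 : (0 : R) < d%:R by rewrite ltr0n.
case: d d0 dk dR0 => // d' _ dk' dR0; apply: le_trans (theta_ge_spline R dk').
set d1 := d'.+1 in dR0 *.
set eta := 2 * _ * _.
have -> : k%:R / d1%:R - pi ^+ 2 * (d1%:R / k%:R) * (1 + pi * d1%:R ^+ 2 / k%:R)
    = k%:R / d1%:R * (1 - eta).
  by rewrite /eta; field; rewrite !lt0r_neq0.
have eta0 : 0 <= eta.
  rewrite /eta !mulr_ge0//.
  by rewrite addr_ge0// divr_ge0// exprn_ge0// divr_ge0// !mulr_ge0// pi_ge0.
rewrite ler_wpM2l ?divr_ge0//.
rewrite -[leRHS]mul1r ler_pdivlMr ?ltr_wpDr//.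
by have := sqr_ge0 eta; lra.
Qed.
End Bounds.

Theorem theorem4 (R : realType) (d : nat) (hd : (3 <= d)%N) :
  (forall k : nat, 4 * d%:R ^+ 3 / pi <= k%:R :> R ->
     k%:R / d%:R - 4 * expR 1 * pi ^+ 2 / 3 * (d%:R / k%:R)
       <= theta R (compl_graph (@circular_clique k d)))
  /\
  (fun k : nat => theta R (compl_graph (@circular_clique k d))) =
    (fun k : nat => k%:R / d%:R) +O_\oo (fun k : nat => k%:R^-1 : R).
Proof.
have pi0 : (0 : R) < pi by exact: pi_gt0.
have pi_ge0 := ltW pi0.
have pi4 : (pi : R) <= 4 by have := pihalf_lt2 R; lra.
have d0 : (0 < d)%N by lia.
have dR3 : (3 : R) <= d%:R by rewrite ler_nat.
have dR0 : (0 : R) < d%:R by lra.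
split.
  move=> k; rewrite ler_pdivrMr// => hk.
  have d3k : d%:R ^+ 3 <= k%:R :> R.
    rewrite -(ler_pM2l (ltr0n R 4)); apply: le_trans hk _.
    by rewrite mulrC ler_wpM2r.
  have dk : (2 * d <= k)%N.
    move: d3k; rewrite -natrX ler_nat; apply: leq_trans.
    by rewrite !expnS expn0 muln1; nia.
  have kR0 : (0 : R) < k%:R by rewrite ltr0n; lia.
  apply: le_trans (theta_circular_clique_ge R d0 dk).
  rewrite lerD2l lerN2 [leRHS](_ : _ = pi ^+ 2 * (d%:R / k%:R) * (4 * expR 1 / 3)); last first.
    by field; rewrite lt0r_neq0.
  rewrite ler_wpM2l ?mulr_ge0 ?divr_ge0 ?(ltW pi0)//.
  have e2 : (2 : R) <= expR 1 by have := expR_ge1Dx (1 : R); lra.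
  (* As e >= 2, the target 4e/3 is at least 8/3 > 1 + 4/3. The bound 4/3 comes from pi d^2/k <=
     pi^2/(4d) <= 16/12. *)
  suff : pi * d%:R ^+ 2 / k%:R <= 4 / 3 :> R by lra.
  rewrite ler_pdivrMr// -(ler_pM2l pi0).
  have pi16 : (pi : R) * pi <= 16 by nra.
  have hd1 := ler_wpM2r (sqr_ge0 (d%:R : R)) pi16.
  have hd2 := ler_wpM2r (sqr_ge0 (d%:R : R)) dR3.
  by rewrite -exprS in hd2; lra.
rewrite eqaddOP; near=> C; near=> k.
have k2d : (2 * d <= k)%N by near: k; exact: nbhs_infty_ge.
have kR1 : (1 : R) <= k%:R by rewrite ler1n; lia.
have kR0 : (0 : R) < k%:R by lra.
have ub := theta_circular_clique_le R d0 k2d.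
have lb := theta_circular_clique_ge R d0 k2d.
rewrite /= distrC ger0_norm ?subr_ge0// ger0_norm ?invr_ge0//.
rewrite lerBlDr -lerBlDl; apply: le_trans lb; rewrite lerD2l lerN2.
rewrite mulrA mulrAC ler_pM2r ?invr_gt0//.
(* Bounding 1/k by 1 in the last factor leaves a constant depending on [d] only. *)
apply: (@le_trans _ _ (pi ^+ 2 * d%:R * (1 + pi * d%:R ^+ 2))).
  rewrite ler_wpM2l ?mulr_ge0 ?sqr_ge0// lerD2l ler_pdivrMr//.
  by rewrite ler_peMr// mulr_ge0 ?sqr_ge0// ltW.
by near: C; apply: nbhs_pinfty_ge; exact: num_real.
Unshelve. all: by end_near.
Qed.
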